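(* Consider any tabular and episodic MDP satisfying the Standard Imitation assumption. For each time step $h\in[H]$ define $\mathcal S^1_h=\{s\in\mathcal S:\widehat P^{\pi^{E}}_h(s)<\rho(s)\}$. Then, for each time step $h$, $\pi^{\mathrm{AIL}}_h(a^1|s)\in[\widehat P^{\pi^{E}}_h(s)/\rho(s),\,1]$ for all $s\in\mathcal S^1_h$ and $\pi^{\mathrm{AIL}}_h(a^1|s)=1$ for all $s\in(\mathcal S^1_h)^c$ are all optimal solutions of the VAIL objective $$\min_{\pi\in\Pi}\sum_{h=1}^H\sum_{(s,a)\in\mathcal S\times\mathcal A}\bigl|P^\pi_h(s,a)-\widehat P^{\pi^{E}}_h(s,a)\bigr|.$$ Furthermore, the largest policy value gap among all globally optimal solutions is $$V^{\pi^{E}}-\mathbb E[V^{\pi^{\mathrm{AIL}}}]=\tfrac12\,\mathbb E\Bigl[\sum_{h=1}^H\bigl\|\widehat P^{\pi^{E}}_h-P^{\pi^{E}}_h\bigr\|_1\Bigr].$$ The optimal policy that incurs the largest policy value gap is $\pi^{\mathrm{AIL}}_h(a^1|s)=\widehat P^{\pi^{E}}_h(s)/\rho(s)$ for all $s\in\mathcal S^1_h$ and $\pi^{\mathrm{AIL}}_h(a^1|s)=1$ for all $s\in(\mathcal S^1_h)^c$ (for each $h\in[H]$).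
   Context: A tabular episodic MDP is a tuple $(\mathcal S,\mathcal A,P,r,H,\rho)$ with finite $\mathcal S,\mathcal A$, horizon $H$, time-dependent transitions $P_h(s'|s,a)$, rewards $r_h:\mathcal S\times\mathcal A\to[0,1]$, and initial state distribution $\rho$; $[H]=\{1,\dots,H\}$. $\Pi$ is the set of all non-stationary stochastic policies $\pi=(\pi_1,\dots,\pi_H)$, $\pi_h:\mathcal S\to\Delta(\mathcal A)$. $V^\pi$ is the expected total reward over $H$ steps; $P^\pi_h(s,a)$ is the probability that $(s_h,a_h)=(s,a)$ under $\pi$. The expert $\pi^{E}$ is deterministic; the dataset $\mathcal D$ consists of i.i.d. length-$H$ trajectories of $\pi^{E}$; $\widehat P^{\pi^{E}}_h(s,a)$ is the fraction of trajectories in $\mathcal D$ with $(s_h,a_h)=(s,a)$ and $\widehat P^{\pi^{E}}_h(s)=\sum_a\widehat P^{\pi^{E}}_h(s,a)$. $\|\cdot\|_1$ is the $\ell_1$ norm over state-action pairs. Expectations are over the random expert dataset. The policy value gap of $\pi$ is $V^{\pi^E}-V^\pi$. Standard Imitation assumption: each state is absorbing and each action has the same transitions, i.e. $P_h(s|s,a)=1$ for all $(s,a)\in\mathcal S\times\mathcal A$, $h\in[H]$; and for any state, $a^1$ is the expert action with reward $1$ and the other actions are non-expert actions with reward $0$.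
   Formalization: Three points are made explicit: the expert dataset is nonempty; there is at least one non-expert action (with only one action the gap formula fails); and the claims that optimal or worst policies must have the stated form are made only at states with ρ(s)>0, since elsewhere the policy is arbitrary. *)

(* Defs.v *)
From HB Require Import structures.
From mathcomp Require Import all_boot all_order all_algebra.
From mathcomp Require Import reals.

Set Implicit Arguments.
Unset Strict Implicit.
Unset Printing Implicit Defensive.
Import Order.TTheory GRing.Theory Num.Theory.
Local Open Scope ring_scope.

Record dist (R : realType) (T : finType) := Dist {
  pmf :> T -> R;
  pmf_ge0 : forall x, 0 <= pmf x;
  pmf_sum1 : \sum_x pmf x = 1 }.

Lemma dirac_pmf_ge0 (R : realType) (T : finType) (x y : T) :
  0 <= (y == x)%:R :> R.
Proof. exact: ler0n. Qed.

Lemma dirac_pmf_sum1 (R : realType) (T : finType) (x : T) :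
  \sum_y (y == x)%:R = 1 :> R.
Proof. by rewrite (bigD1 x) //= eqxx big1 ?addr0 // => y /negPf->. Qed.

Definition dirac_dist (R : realType) (T : finType) (x : T) : dist R T :=
  Dist (dirac_pmf_ge0 R x) (dirac_pmf_sum1 R x).

(* Time steps are indexed by 'I_H, so step h of [H] = {1, .., H} is the ordinal
   h - 1. The last transition kernel plays no role in the length-H process. *)
Record mdp (R : realType) (S A : finType) (H : nat) := MDP {
  trans : 'I_H -> S -> A -> dist R S;
  rew : 'I_H -> S -> A -> R;
  init : dist R S;
  rew_itv : forall h s a, 0 <= rew h s a <= 1 }.

Definition policy (R : realType) (S A : finType) (H : nat) :=
  'I_H -> S -> dist R A.

Definition det_policy (R : realType) (S A : finType) (H : nat)
    (f : 'I_H -> S -> A) : policy R S A H :=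
  fun h s => dirac_dist R (f h s).

Definition traj (S A : finType) (H : nat) := {ffun 'I_H -> S * A}.

Definition dataset (S A : finType) (H m : nat) := {ffun 'I_m -> traj S A H}.

Section Process.
Variables (R : realType) (S A : finType) (H : nat) (M : mdp R S A H).
Implicit Types (pi : policy R S A H) (h : 'I_H) (x : S * A).

(* rho(s_1) prod_h pi_h(a_h | s_h) prod_{h < H} P_h(s_{h+1} | s_h, a_h); the
   last product ranges over the pairs (h, k) of consecutive time steps. *)
Definition traj_pr pi (t : traj S A H) : R :=
  (\prod_(h < H | val h == 0%N) init M (t h).1) *
  (\prod_(h < H) pi h (t h).1 (t h).2) *
  (\prod_(h < H) \prod_(k < H | val k == h.+1)
     trans M h (t h).1 (t h).2 (t k).1).

Definition occ pi h x : R := \sum_(t : traj S A H | t h == x) traj_pr pi t.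

Definition value pi : R :=
  \sum_(t : traj S A H) traj_pr pi t * \sum_(h < H) rew M h (t h).1 (t h).2.

End Process.

Definition l1norm (R : realType) (T : finType) (f : T -> R) : R :=
  \sum_x `|f x|.

Section Dataset.
Variables (R : realType) (S A : finType) (H m : nat).
Variables (M : mdp R S A H) (piE : 'I_H -> S -> A).
Implicit Types (pi : policy R S A H) (D : dataset S A H m) (h : 'I_H).

Definition dataset_pr D : R :=
  \prod_(i < m) traj_pr M (det_policy R piE) (D i).

Definition expectation (X : dataset S A H m -> R) : R :=
  \sum_D dataset_pr D * X D.

Definition emp D h (x : S * A) : R :=
  #|[set i : 'I_m | D i h == x]|%:R / m%:R.

Definition emp_state D h (s : S) : R := \sum_(a : A) emp D h (s, a).

Definition value_gap pi : R := value M (det_policy R piE) - value M pi.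

Definition vail_loss D pi : R :=
  \sum_(h < H) l1norm (fun x => occ M pi h x - emp D h x).

Definition vail_optimal D pi : Prop :=
  forall pi' : policy R S A H, vail_loss D pi <= vail_loss D pi'.

Definition vail_worst D pi : Prop :=
  vail_optimal D pi /\
  forall pi', vail_optimal D pi' -> value_gap pi' <= value_gap pi.

(* A dataset-dependent choice of a VAIL solution. Optimality is required almost
   surely, i.e. for the datasets the expert produces with positive
   probability. *)
Definition vail_rule (piAIL : dataset S A H m -> policy R S A H) : Prop :=
  forall D, 0 < dataset_pr D -> vail_optimal D (piAIL D).

Definition underobserved D h : {set S} :=
  [set s | emp_state D h s < init M s].

Definition ail_range (a1 : A) D pi h (s : S) : Prop :=
  (s \in underobserved D h ->
     emp_state D h s / init M s <= pi h s a1 <= 1) /\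
  (s \notin underobserved D h -> pi h s a1 = 1).

Definition ail_lowest (a1 : A) D pi h (s : S) : Prop :=
  (s \in underobserved D h -> pi h s a1 = emp_state D h s / init M s) /\
  (s \notin underobserved D h -> pi h s a1 = 1).

End Dataset.

(* The last clause records that there are other, non-expert actions: the policies
   attaining the largest gap put mass on them. *)
Definition standard_imitation (R : realType) (S A : finType) (H : nat)
    (M : mdp R S A H) (piE : 'I_H -> S -> A) (a1 : A) : Prop :=
  [/\ forall h s a, trans M h s a s = 1,
      forall h s, piE h s = a1,
      forall h s, rew M h s a1 = 1,
      forall h s a, a != a1 -> rew M h s a = 0
    & exists a, a != a1].

(* Main.v *)
Require Import Defs.
From HB Require Import structures.
From mathcomp Require Import all_boot all_order all_algebra.
From mathcomp Require Import reals.
From mathcomp Require Import lra.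

(* Since states are absorbing and actions do not move the state, a trajectory
   stays in its initial state, so that P^pi_h(s, a) = rho(s) pi_h(a | s). On a
   dataset the expert can produce, only the action a1 is observed, and the VAIL
   loss splits into independent terms |r p - e| + r (1 - p), one for each (h, s),
   with r = rho(s), e the empirical frequency of s at step h and
   p = pi_h(a1 | s). By the triangle inequality each term is at least |r - e|,
   and p = 1 (the expert) attains this bound; equality describes the optimal
   policies. The policy value gap is the sum of the terms r (1 - p), which at an
   optimum are at most the positive part of r - e. Since r and e both sum to 1
   over the states, these positive parts sum to half the l1 distance. *)

Set Implicit Arguments.
Unset Strict Implicit.
Unset Printing Implicit Defensive.
Import Order.TTheory GRing.Theory Num.Theory.
Local Open Scope ring_scope.

(** * Scalar terms of the loss, for one step and one state *)

Section RealFacts.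
Variable R : realType.
Implicit Types r e p : R.

Lemma term_ge r e p : 0 <= r -> p <= 1 ->
  `|r - e| <= `|r * p - e| + r * (1 - p).
Proof.
move=> r0 p1; have rp : 0 <= r * (1 - p) by rewrite mulr_ge0 // subr_ge0.
rewrite -[X in _ <= _ + X](ger0_norm rp).
apply: le_trans (ler_normD _ _).
by rewrite (_ : r * p - e + _ = r - e) //; lra.
Qed.

(** Since [r * p <= r], equality in the triangle inequality means that [r * p] lies between [e] and
    [r]; the two implications express this according to the order of [e] and [r]. *)
Lemma term_eqP r e p : 0 < r -> p <= 1 ->
  `|r * p - e| + r * (1 - p) = `|r - e| :> R <->
  (e < r -> e / r <= p) /\ (r <= e -> p = 1).
Proof.
move=> r0 p1; rewrite mulrBr mulr1.
have rp : r * p <= r by rewrite ler_piMr // ltW.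
split=> [eq|[lt_imp ge_imp]].
  split=> er.
    rewrite ler_pdivrMr // mulrC leNgt; apply/negP => lt_e; move: eq.
    rewrite ltr0_norm ?subr_lt0 // ger0_norm ?subr_ge0 ?ltW //.
    lra.
  have : r * p = r.
    move: eq; rewrite ler0_norm ?subr_le0 ?(le_trans rp) //.
    rewrite ler0_norm ?subr_le0 // => eq; lra.
  by rewrite -[RHS]mulr1 => /(mulfI (lt0r_neq0 r0)).
case: (ltP e r) => er; last by rewrite (ge_imp er) mulr1 subrr addr0.
have := lt_imp er; rewrite ler_pdivrMr // mulrC => le_e.
by rewrite !ger0_norm ?subr_ge0 ?(ltW er) //; lra.
Qed.

(** The bound is the positive part of [r - e]; it comes from [e - r * p] being at most its absolute
    value. *)
Lemma term_eq_gap_le r e p : `|r * p - e| + r * (1 - p) = `|r - e| :> R ->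
  r * (1 - p) <= (`|r - e| + (r - e)) / 2.
Proof. by have := ler_norm (- (r * p - e)); rewrite normrN; lra. Qed.

(** A maximal gap caps [r * p] from above; optimality supplies the matching lower bound. *)
Lemma term_eq_gap_eq r e p : `|r * p - e| + r * (1 - p) = `|r - e| :> R ->
  r * (1 - p) = (`|r - e| + (r - e)) / 2 -> r * p <= e.
Proof. by have := ler_norm (r * p - e); lra. Qed.

(** * Finite distributions and product measures *)

Lemma dist_le1 (T : finType) (d : dist R T) x : d x <= 1.
Proof.
rewrite -(pmf_sum1 d) (bigD1 x) //= lerDl.
by apply: sumr_ge0 => y _; apply: pmf_ge0.
Qed.

Lemma dist_sure (T : finType) (d : dist R T) x y : d x = 1 -> d y = (y == x)%:R.
Proof.
move=> dx; case: eqVneq => [->//|yx].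
have : \sum_(z | z != x) d z = 0.
  apply: (addrI 1); rewrite addr0 -[RHS](pmf_sum1 d) [RHS](bigD1 x) //=.
  by rewrite dx.
by move/psumr_eq0P => /(_ (fun z _ => pmf_ge0 d z)) /(_ y yx).
Qed.

Lemma sum_prod_ffun (I T : finType) (g : I -> T -> R) :
  (forall i, \sum_x g i x = 1) ->
  \sum_(t : {ffun I -> T}) \prod_i g i (t i) = 1.
Proof. by move=> g1; rewrite -bigA_distr_bigA /= big1. Qed.

Lemma marginal_prod_ffun (I T : finType) (g : I -> T -> R) i x :
  (forall i, \sum_x g i x = 1) ->
  \sum_(t : {ffun I -> T} | t i == x) \prod_j g j (t j) = g i x.
Proof.
(* The indicator of [t i = x] becomes a factor of the product, so the restricted sum turns into a
   full one and distributivity applies. *)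
move=> g1; pose c j y : R := if j == i then (y == x)%:R else 1.
transitivity (\sum_(t : {ffun I -> T}) \prod_j (c j (t j) * g j (t j))).
  rewrite big_mkcond; apply: eq_bigr => t _; rewrite big_split /=.
  have -> : \prod_j c j (t j) = (t i == x)%:R.
    rewrite (bigD1 i) //= /c eqxx big1 ?mulr1 // => j.
    by move=> /negPf ->.
  by case: eqP => _; rewrite ?mul1r ?mul0r.
rewrite -(bigA_distr_bigA (fun j y => c j y * g j y)) (bigD1 i) //=.
rewrite [X in _ * X]big1 ?mulr1 => [|j ji]; last first.
  by rewrite -(g1 j); apply: eq_bigr => y _; rewrite /c (negPf ji) mul1r.
rewrite (bigD1 x) //= /c eqxx eqxx mul1r big1 ?addr0 // => y /negPf yx.
by rewrite yx mul0r.
Qed.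

Definition two_point_pmf (T : finType) (x y : T) p (z : T) : R :=
  p * (z == x)%:R + (1 - p) * (z == y)%:R.

Lemma two_point_ge0 (T : finType) (x y : T) p : 0 <= p <= 1 ->
  forall z, 0 <= two_point_pmf x y p z.
Proof. by case/andP=> p0 p1 z; rewrite addr_ge0 ?mulr_ge0 ?subr_ge0. Qed.

Lemma two_point_sum1 (T : finType) (x y : T) p :
  \sum_z two_point_pmf x y p z = 1.
Proof.
by rewrite big_split /= -!mulr_sumr !dirac_pmf_sum1 !mulr1 addrC subrK.
Qed.

(** The sigma type lets policies be assembled state by state without a choice principle. *)
Lemma dist_with_mass (T : finType) (x y : T) p : y != x -> 0 <= p <= 1 ->
  {d : dist R T | d x = p}.
Proof.
move=> yx p01; exists (Dist (two_point_ge0 x y p01) (two_point_sum1 x y p)).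
by rewrite /= /two_point_pmf eqxx eq_sym (negPf yx) mulr1 mulr0 addr0.
Qed.

End RealFacts.

(** * Values, empirical frequencies and absorbing trajectories *)

Lemma value_occ (R : realType) (S A : finType) (H : nat) (M : mdp R S A H)
    (pi : policy R S A H) :
  value M pi = \sum_(h < H) \sum_(x : S * A) occ M pi h x * rew M h x.1 x.2.
Proof.
rewrite /value; under eq_bigr do rewrite mulr_sumr.
rewrite exchange_big /=; apply: eq_bigr => h _.
rewrite (partition_big (fun t : traj S A H => t h) xpredT) //=.
apply: eq_bigr => x _; rewrite mulr_suml.
by apply: eq_bigr => t /eqP ->.
Qed.

Lemma emp_ge0 (R : realType) (S A : finType) (H m : nat)
    (D : dataset S A H m) h x : 0 <= emp R D h x.
Proof. by rewrite divr_ge0. Qed.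

Lemma emp_state_ge0 (R : realType) (S A : finType) (H m : nat)
    (D : dataset S A H m) h s : 0 <= emp_state R D h s.
Proof. by apply: sumr_ge0 => a _; apply: emp_ge0. Qed.

Lemma emp_state_sum1 (R : realType) (S A : finType) (H m : nat)
    (D : dataset S A H m) h : (0 < m)%N -> \sum_s emp_state R D h s = 1.
Proof.
move=> m0; rewrite /emp_state pair_big /= -mulr_suml.
rewrite (_ : \sum_p _ = m%:R) ?divff ?pnatr_eq0 -?lt0n //.
rewrite -natr_sum -[in RHS](card_ord m) -sum1_card; congr _%:R.
rewrite (partition_big (fun i : 'I_m => D i h) xpredT) //=.
apply: eq_bigr => -[s a] _; rewrite -sum1_card.
by apply: eq_bigl => i; rewrite inE.
Qed.

(** Serves to find, in a trajectory that changes state, two consecutive steps where it does. *)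
Lemma consecutive_constant (T : Type) n (f : 'I_n.+1 -> T) :
  (forall h k : 'I_n.+1, val k = h.+1 -> f k = f h) -> forall h, f h = f ord0.
Proof.
move=> step [i lt_i]; elim: i lt_i => [|i IH] lt_i.
  by congr f; apply: val_inj.
by rewrite (step (Ordinal (ltnW lt_i))) ?IH.
Qed.

(* For H > 0 only the summand at the initial state of t is nonzero; writing the
   sum makes the formula valid for H = 0 as well. *)
Lemma absorbing_traj_pr (R : realType) (S A : finType) (H : nat)
    (M : mdp R S A H) (pi : policy R S A H) (t : traj S A H) :
  (forall h s a s', trans M h s a s' = (s' == s)%:R) ->
  traj_pr M pi t =
  \sum_s init M s * \prod_(h < H) (((t h).1 == s)%:R * pi h s (t h).2).
Proof.
move=> transE; rewrite /traj_pr.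
under [X in _ * X]eq_bigr do under eq_bigr do rewrite transE.
case: H M pi t {transE} => [|n] M pi t.
  rewrite !big_ord0 !mulr1; under eq_bigr do rewrite big_ord0 mulr1.
  by rewrite pmf_sum1.
rewrite (big_pred1 ord0) //=.
rewrite [RHS](bigD1 (t ord0).1) //= [X in _ = _ + X]big1 ?addr0; last first.
  move=> s s0; rewrite (bigD1 ord0) //= eq_sym (negPf s0) !mul0r mulr0 //.
(* If the state never changes, all transition factors are 1. Otherwise both sides vanish, the left
   one through the transition factor at a jump between consecutive steps. *)
have [const|] := boolP [forall h, (t h).1 == (t ord0).1].
  move/forallP in const; rewrite [X in _ * _ * X]big1 ?mulr1.
    congr (_ * _); apply: eq_bigr => h _; rewrite const mul1r.
    by rewrite (eqP (const h)).
  move=> h _; rewrite big1 // => k _.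
  by rewrite (eqP (const h)) (eqP (const k)) eqxx.
move=> nconst; have [h ne] := forallPn nconst.
rewrite [in RHS](bigD1 h) //= (negPf ne) !mul0r mulr0.
have [/existsP[h' /existsP[k /andP[/eqP kh ne']]]|nstep] := boolP
    [exists h' : 'I_n.+1, [exists k : 'I_n.+1,
      (val k == h'.+1) && ((t k).1 != (t h').1)]].
  apply/eqP; rewrite mulf_eq0; apply/orP; right.
  apply/prodf_eq0; exists h' => //; apply/prodf_eq0.
  by exists k; rewrite ?(negPf ne') //; apply/eqP.
case/negP: ne; apply/eqP; move: h.
apply: (consecutive_constant (f := fun h => (t h).1)) => h' k kh.
apply: contraNeq nstep => ne'; apply/existsP; exists h'; apply/existsP.
by exists k; rewrite kh eqxx.
Qed.

(** * Occupancies, values and expectations under Standard Imitation *)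

Section StandardImitation.
Variables (R : realType) (S A : finType) (H m : nat).
Variables (M : mdp R S A H) (piE : 'I_H -> S -> A) (a1 : A).
Hypotheses (hm : (0 < m)%N) (hM : standard_imitation M piE a1).
Implicit Types (pi : policy R S A H) (D : dataset S A H m) (h : 'I_H) (s : S).

Let rho := init M.
Let expert := det_policy R piE.

Lemma transE h s a s' : trans M h s a s' = (s' == s)%:R.
Proof. by case: hM => tr _ _ _ _; apply: dist_sure. Qed.

Lemma absorbed_sum1 pi s h :
  \sum_(x : S * A) ((x.1 == s)%:R * pi h s x.2) = 1.
Proof.
rewrite -(pair_bigA _ (fun s' a => (s' == s)%:R * pi h s a)) /=.
under eq_bigr do rewrite -mulr_sumr pmf_sum1 mulr1.
exact: dirac_pmf_sum1.
Qed.

Lemma traj_pr_sum1 pi : \sum_t traj_pr M pi t = 1.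
Proof.
under eq_bigr do rewrite (absorbing_traj_pr _ _ transE).
rewrite exchange_big /= -[RHS](pmf_sum1 rho); apply: eq_bigr => s _.
rewrite -mulr_sumr -[RHS]mulr1; congr (_ * _).
apply: (sum_prod_ffun (g := fun h x => (x.1 == s)%:R * pi h s x.2)) => h.
exact: absorbed_sum1.
Qed.

Lemma traj_pr_ge0 pi t : 0 <= traj_pr M pi t.
Proof.
rewrite (absorbing_traj_pr _ _ transE); apply: sumr_ge0 => s _.
rewrite mulr_ge0 ?pmf_ge0 // prodr_ge0 // => h _.
by rewrite mulr_ge0 ?pmf_ge0 ?ler0n.
Qed.

(** Given the initial state [s], the trajectory law is a product measure, whose marginal at [h] is
    carried by [s]; averaging over [s] leaves only [s = x.1]. *)
Lemma occE pi h x : occ M pi h x = rho x.1 * pi h x.1 x.2.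
Proof.
rewrite /occ; under eq_bigr do rewrite (absorbing_traj_pr _ _ transE).
rewrite exchange_big /=.
transitivity (\sum_s rho s * ((x.1 == s)%:R * pi h s x.2)).
  apply: eq_bigr => s _; rewrite -mulr_sumr; congr (_ * _).
  apply: (marginal_prod_ffun (g := fun h x => (x.1 == s)%:R * pi h s x.2)).
  by move=> h'; apply: absorbed_sum1.
rewrite (bigD1 x.1) //= eqxx mul1r big1 ?addr0 // => s /negPf.
by rewrite eq_sym => ->; rewrite mul0r mulr0.
Qed.

Lemma valueE pi : value M pi = \sum_(h < H) \sum_s rho s * pi h s a1.
Proof.
case: hM => _ _ r1 r0 _; rewrite value_occ; apply: eq_bigr => h _.
rewrite -(pair_bigA _ (fun s a => occ M pi h (s, a) * rew M h s a)) /=.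
apply: eq_bigr => s _; rewrite (bigD1 a1) //= r1 mulr1 big1 ?addr0 ?occE //.
by move=> a /r0 ->; rewrite mulr0.
Qed.

Lemma expert_prob1 h s : expert h s a1 = 1.
Proof. by case: hM => _ piE1 _ _ _; rewrite /expert /= piE1 eqxx. Qed.

Lemma value_gapE pi :
  value_gap M piE pi = \sum_(h < H) \sum_s rho s * (1 - pi h s a1).
Proof.
rewrite /value_gap !valueE -sumrB; apply: eq_bigr => h _.
by rewrite -sumrB; apply: eq_bigr => s _; rewrite expert_prob1 mulrBr.
Qed.

Lemma dataset_pr_ge0 D : 0 <= dataset_pr M piE D.
Proof. by apply: prodr_ge0 => i _; apply: traj_pr_ge0. Qed.

Lemma dataset_pr_sum1 : \sum_(D : dataset S A H m) dataset_pr M piE D = 1.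
Proof.
apply: (sum_prod_ffun (g := fun=> traj_pr M expert)) => _.
exact: traj_pr_sum1.
Qed.

(** Datasets of probability zero contribute nothing to either side. *)
Lemma expectation_le (X Y : dataset S A H m -> R) :
  (forall D, 0 < dataset_pr M piE D -> X D <= Y D) ->
  expectation M piE X <= expectation M piE Y.
Proof.
move=> le_XY; apply: ler_sum => D _.
have := dataset_pr_ge0 D; rewrite le_eqVlt => /orP[/eqP<-|D0].
  by rewrite !mul0r.
by rewrite ler_pM2l ?le_XY.
Qed.

Lemma expectation_eq (X Y : dataset S A H m -> R) :
  (forall D, 0 < dataset_pr M piE D -> X D = Y D) ->
  expectation M piE X = expectation M piE Y.
Proof.
by move=> eq; apply/eqP; rewrite eq_le !expectation_le // => D /eq ->.
Qed.

Lemma expectation_value_gap (piAIL : dataset S A H m -> policy R S A H) :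
  value M expert - expectation M piE (fun D => value M (piAIL D)) =
  expectation M piE (fun D => value_gap M piE (piAIL D)).
Proof.
rewrite /expectation /value_gap -[X in X - _]mul1r -dataset_pr_sum1 mulr_suml.
by rewrite -sumrB; apply: eq_bigr => D _; rewrite mulrBr.
Qed.

(** The largest gap among the VAIL optima of a possible dataset [D], in terms of state frequencies
    only. *)
Definition max_gap D : R :=
  1 / 2 * \sum_(h < H) \sum_s `|rho s - emp_state R D h s|.

(** The added differences cancel over the states; the positive parts can then be compared with the
    gap term by term. *)
Lemma max_gapE D : max_gap D =
  \sum_(h < H) \sum_s
    (`|rho s - emp_state R D h s| + (rho s - emp_state R D h s)) / 2.
Proof.
rewrite /max_gap mulr_sumr; apply: eq_bigr => h _.
rewrite -mulr_suml big_split sumrB /= pmf_sum1 emp_state_sum1 //.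
by rewrite subrr addr0 mul1r mulrC.
Qed.

(** * VAIL optima for a dataset of positive probability *)

Section PossibleDataset.
Variable D : dataset S A H m.
Hypothesis D_gt0 : 0 < dataset_pr M piE D.

Lemma emp_nonexpert h s a : a != a1 -> emp R D h (s, a) = 0.
Proof.
move=> a_a1; rewrite /emp (_ : [set _ | _] = set0) ?cards0 ?mul0r //.
apply/setP => i; rewrite !inE; apply/negbTE/negP => /eqP Dih.
(* A trajectory containing a non-expert action would give the whole dataset probability zero. *)
have /prodf_neq0/(_ i isT) : dataset_pr M piE D != 0 by rewrite gt_eqF.
rewrite /traj_pr !mulf_eq0 !negb_or -andbA => /and3P[_ /prodf_neq0 + _].
case: hM => _ piE1 _ _ _ => /(_ h isT).
by rewrite Dih /= piE1 (negPf a_a1) eqxx.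
Qed.

Lemma emp_expert h s : emp R D h (s, a1) = emp_state R D h s.
Proof.
by rewrite /emp_state (bigD1 a1) //= big1 ?addr0 // => a /emp_nonexpert ->.
Qed.

Lemma l1norm_occ_emp pi h :
  l1norm (fun x => occ M pi h x - emp R D h x) =
  \sum_s (`|rho s * pi h s a1 - emp_state R D h s| + rho s * (1 - pi h s a1)).
Proof.
rewrite /l1norm -(pair_bigA _ (fun s a =>
  `|occ M pi h (s, a) - emp R D h (s, a)|)) /=.
apply: eq_bigr => s _; rewrite (bigD1 a1) //= emp_expert occE; congr (_ + _).
have -> : 1 - pi h s a1 = \sum_(a | a != a1) pi h s a.
  by rewrite -(pmf_sum1 (pi h s)) (bigD1 a1) //= addrAC subrr add0r.
rewrite mulr_sumr.
apply: eq_bigr => a /emp_nonexpert ->; rewrite subr0 occE ger0_norm //.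
by rewrite mulr_ge0 ?pmf_ge0.
Qed.

(** The expert attains all termwise lower bounds at once, so optimality of the sum is optimality of
    every term. *)
Lemma vail_optimalP pi : vail_optimal M D pi <->
  forall h s, `|rho s * pi h s a1 - emp_state R D h s|
    + rho s * (1 - pi h s a1) = `|rho s - emp_state R D h s|.
Proof.
pose b := \sum_(h < H) \sum_s `|rho s - emp_state R D h s|.
(* The loss is a constant independent of the policy plus nonnegative excesses. *)
have lossE pi' : vail_loss M D pi' = b + \sum_(h < H) \sum_s
    (`|rho s * pi' h s a1 - emp_state R D h s| + rho s * (1 - pi' h s a1)
     - `|rho s - emp_state R D h s|).
  rewrite /b -big_split; apply: eq_bigr => h _ /=.
  rewrite l1norm_occ_emp -big_split /=.
  by apply: eq_bigr => s _; rewrite addrC subrK.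
have diff_ge0 pi' h s :
    0 <= `|rho s * pi' h s a1 - emp_state R D h s| + rho s * (1 - pi' h s a1)
     - `|rho s - emp_state R D h s|.
  by rewrite subr_ge0 term_ge ?pmf_ge0 ?dist_le1.
split=> [opt h s|eq pi']; last first.
  rewrite !lossE lerD2l [X in X <= _]big1 => [|h _].
    by apply: sumr_ge0 => h _; apply: sumr_ge0.
  by apply: big1 => s _; rewrite eq subrr.
(* The excess of the expert is zero, hence so is the total excess of [pi], and each of its terms. *)
have := opt expert; rewrite !lossE lerD2l.
rewrite [X in _ <= X]big1 => [le0|{}h _]; last first.
  by apply: big1 => {}s _; rewrite expert_prob1 mulr1 subrr mulr0 addr0 subrr.
have sum0 : \sum_(h < H) \sum_s
    (`|rho s * pi h s a1 - emp_state R D h s| + rho s * (1 - pi h s a1)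
     - `|rho s - emp_state R D h s|) = 0.
  by apply/le_anti/andP; split=> //; do 2!apply: sumr_ge0 => ? _.
have /psumr_eq0P sum0h := sum0.
have /psumr_eq0P sum0hs :=
  sum0h (fun h _ => sumr_ge0 _ (fun s _ => diff_ge0 pi h s)) h isT.
by apply/eqP; rewrite -subr_eq0; apply/eqP/sum0hs.
Qed.

Lemma ail_range_optimal pi :
  (forall h s, ail_range M a1 D pi h s) -> vail_optimal M D pi.
Proof.
move=> range; apply/vail_optimalP => h s.
have [lo hi] := range h s; rewrite inE in lo hi.
(* States with [rho s = 0] fall in the second case, so [term_eqP] is applied only where [rho s] is
   positive. *)
have [lt|ge] := ltP (emp_state R D h s) (rho s); last first.
  by rewrite hi -?leNgt // mulr1 subrr mulr0 addr0.
have /andP[le_p p1] := lo lt.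
apply/term_eqP; rewrite ?(le_lt_trans _ lt) ?emp_state_ge0 //; split=> //.
by move=> /(lt_le_trans lt); rewrite ltxx.
Qed.

(** Where [init M s] vanishes, the loss term does not depend on the policy, so optimality says
    nothing there. *)
Lemma optimal_ail_range pi : vail_optimal M D pi ->
  forall h s, 0 < init M s -> ail_range M a1 D pi h s.
Proof.
move=> /vail_optimalP opt h s rho0.
have /term_eqP := opt h s; case=> //; first exact: dist_le1.
move=> lo hi; split; rewrite inE; last by rewrite -leNgt => /hi.
by move=> /lo ->; rewrite dist_le1.
Qed.

Lemma ail_lowest_range pi h s :
  ail_lowest M a1 D pi h s -> ail_range M a1 D pi h s.
Proof. by case=> lo hi; split=> // /lo <-; rewrite lexx dist_le1. Qed.

Lemma ail_lowest_optimal pi :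
  (forall h s, ail_lowest M a1 D pi h s) -> vail_optimal M D pi.
Proof.
by move=> low; apply: ail_range_optimal => h s; apply: ail_lowest_range.
Qed.

Lemma ail_lowest_gap pi :
  (forall h s, ail_lowest M a1 D pi h s) -> value_gap M piE pi = max_gap D.
Proof.
move=> low; rewrite value_gapE max_gapE.
apply: eq_bigr => h _; apply: eq_bigr => s _.
have [lo hi] := low h s; rewrite inE in lo hi.
have [lt|ge] := ltP (emp_state R D h s) (rho s); last first.
  rewrite hi -?leNgt // subrr mulr0 ler0_norm ?subr_le0 //.
  by rewrite addNr mul0r.
have rho0 : 0 < rho s := le_lt_trans (emp_state_ge0 _ _ _ _) lt.
rewrite lo // mulrBr mulr1 mulrCA divff ?gt_eqF // mulr1.
by rewrite ger0_norm ?subr_ge0 ?ltW //; lra.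
Qed.

Lemma optimal_gap_le pi :
  vail_optimal M D pi -> value_gap M piE pi <= max_gap D.
Proof.
move=> /vail_optimalP opt; rewrite value_gapE max_gapE.
by do 2!apply: ler_sum => ? _; apply: term_eq_gap_le.
Qed.

Lemma ail_lowest_exists :
  {low : policy R S A H | forall h s, ail_lowest M a1 D low h s}.
Proof.
pose p h s := if s \in underobserved M D h
  then emp_state R D h s / init M s else 1.
(* The non-expert action [a0] receives the mass withheld from [a1]. *)
have /sigW[a0 a01] : exists a, a != a1 by case: hM.
have p01 h s : 0 <= p h s <= 1.
  rewrite /p inE; case: ltP => [lt|_]; last by rewrite ler01 lexx.
  have rho0 : 0 < init M s := le_lt_trans (emp_state_ge0 _ _ _ _) lt.
  by rewrite divr_ge0 ?emp_state_ge0 ?pmf_ge0 //= ler_pdivrMr // mul1r ltW.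
pose d h s := dist_with_mass a01 (p01 h s).
exists (fun h s => sval (d h s)) => h s; rewrite /ail_lowest (svalP (d h s)) /p.
by split=> [->|/negPf ->].
Qed.

Lemma ail_lowest_worst pi :
  (forall h s, ail_lowest M a1 D pi h s) -> vail_worst M piE D pi.
Proof.
move=> low; split; first exact: ail_lowest_optimal.
by move=> pi' /optimal_gap_le; rewrite (ail_lowest_gap low).
Qed.

(** Comparison with a lowest policy shows that the gap equals [max_gap D]; the termwise slacks are
    nonnegative with sum zero, so each bound is attained. *)
Lemma worst_ail_lowest pi : vail_worst M piE D pi ->
  forall h s, 0 < init M s -> ail_lowest M a1 D pi h s.
Proof.
move=> [opt worst] h s rho0.
have [pi0 low0] := ail_lowest_exists.
have gap_max : value_gap M piE pi = max_gap D.
  apply/le_anti; rewrite optimal_gap_le //= -(ail_lowest_gap low0).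
  exact/worst/ail_lowest_optimal.
have /vail_optimalP eqs := opt.
have slack_ge0 h' s' : 0 <=
    (`|rho s' - emp_state R D h' s'| + (rho s' - emp_state R D h' s')) / 2
    - rho s' * (1 - pi h' s' a1).
  by rewrite subr_ge0 term_eq_gap_le.
have slack0 : \sum_(h < H) \sum_s
    ((`|rho s - emp_state R D h s| + (rho s - emp_state R D h s)) / 2
     - rho s * (1 - pi h s a1)) = 0.
  under eq_bigr do rewrite sumrB.
  by rewrite sumrB -max_gapE -value_gapE gap_max subrr.
have /psumr_eq0P slack0h := slack0.
have /psumr_eq0P slack0hs :=
  slack0h (fun h _ => sumr_ge0 _ (fun s _ => slack_ge0 h s)) h isT.
have /eqP := slack0hs (fun s _ => slack_ge0 h s) s isT.
rewrite subr_eq0 eq_sym => /eqP /(term_eq_gap_eq (eqs h s)) le_e.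
(* Optimality gives the reverse inequality to [le_e] on the underobserved states. *)
have [range hi] := optimal_ail_range opt h rho0.
split=> // /range /andP[ge_e _]; apply/le_anti; rewrite ge_e andbT.
by rewrite ler_pdivlMr // mulrC.
Qed.

End PossibleDataset.

(** On a possible dataset this distance is the loss of the expert, where both measures live on [a1]
    and only state frequencies remain. *)
Lemma largest_gapE :
  1 / 2 * expectation M piE (fun D : dataset S A H m =>
    \sum_(h < H) l1norm (fun x => emp R D h x - occ M expert h x)) =
  expectation M piE max_gap.
Proof.
rewrite /expectation mulr_sumr -/(expectation M piE max_gap).
transitivity (expectation M piE (fun D : dataset S A H m =>
    1 / 2 * \sum_(h < H) l1norm (fun x => emp R D h x - occ M expert h x))).
  by apply: eq_bigr => D _; rewrite mulrCA.
apply: expectation_eq => D D0; congr (_ * _); apply: eq_bigr => h _.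
rewrite (_ : l1norm _ = l1norm (fun x => occ M expert h x - emp R D h x)).
  rewrite l1norm_occ_emp //; apply: eq_bigr => s _.
  by rewrite expert_prob1 mulr1 subrr mulr0 addr0.
by apply: eq_bigr => x _; rewrite distrC.
Qed.

End StandardImitation.

Theorem proposition1 (R : realType) (S A : finType) (H m : nat)
    (M : mdp R S A H) (piE : 'I_H -> S -> A) (a1 : A)
    (hm : (0 < m)%N) (hM : standard_imitation M piE a1) :
  (* for almost every dataset, the displayed policies are optimal, and, up to
     the states of initial probability zero, they are all the optimal ones *)
  (forall D : dataset S A H m, 0 < dataset_pr M piE D ->
     (forall pi : policy R S A H,
        (forall h s, ail_range M a1 D pi h s) -> vail_optimal M D pi) /\
     (forall pi : policy R S A H, vail_optimal M D pi ->
        forall h s, 0 < init M s -> ail_range M a1 D pi h s)) /\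
  (* the largest policy value gap *)
  (let largest_gap :=
     1 / 2 * expectation M piE (fun D : dataset S A H m =>
       \sum_(h < H)
         l1norm (fun x => emp R D h x - occ M (det_policy R piE) h x)) in
   [/\ exists piAIL : dataset S A H m -> policy R S A H,
         vail_rule M piE piAIL /\
         value M (det_policy R piE)
           - expectation M piE (fun D => value M (piAIL D)) = largest_gap,
       forall piAIL : dataset S A H m -> policy R S A H,
         vail_rule M piE piAIL ->
         value M (det_policy R piE)
           - expectation M piE (fun D => value M (piAIL D)) <= largest_gap
     & forall piAIL : dataset S A H m -> policy R S A H,
         (forall D, 0 < dataset_pr M piE D ->
            forall h s, ail_lowest M a1 D (piAIL D) h s) ->
         value M (det_policy R piE)
           - expectation M piE (fun D => value M (piAIL D)) = largest_gap]) /\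
  (* the optimal policies incurring the largest policy value gap *)
  (forall D : dataset S A H m, 0 < dataset_pr M piE D ->
     [/\ exists pi : policy R S A H, forall h s, ail_lowest M a1 D pi h s,
         forall pi : policy R S A H,
           (forall h s, ail_lowest M a1 D pi h s) -> vail_worst M piE D pi
       & forall pi : policy R S A H, vail_worst M piE D pi ->
           forall h s, 0 < init M s -> ail_lowest M a1 D pi h s]).
Proof.
split=> [D D0|]; first split.
- by move=> pi; apply: (ail_range_optimal hM).
- by move=> pi; apply: (optimal_ail_range hM).
split=> [|D D0]; last split.
- move=> largest_gap.
  have lowest_gap (piAIL : dataset S A H m -> policy R S A H) :
      (forall D, 0 < dataset_pr M piE D ->
         forall h s, ail_lowest M a1 D (piAIL D) h s) ->
      value M (det_policy R piE)
        - expectation M piE (fun D => value M (piAIL D)) = largest_gap.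
    move=> low; rewrite (expectation_value_gap hM) /largest_gap.
    rewrite (largest_gapE m hM); apply: (expectation_eq hM) => D D0.
    exact: (ail_lowest_gap hm hM (low D D0)).
  (* The third clause is [lowest_gap]; it also evaluates the witness of the first, a lowest policy
     taken for each dataset. *)
  split=> //.
  + exists (fun D => sval (ail_lowest_exists hM D)); split=> [D D0|].
      by case: ail_lowest_exists => pi /=; apply: (ail_lowest_optimal hM).
    by apply: lowest_gap => D _; case: ail_lowest_exists.
  + move=> piAIL opt; rewrite (expectation_value_gap hM) /largest_gap.
    rewrite (largest_gapE m hM); apply: (expectation_le hM) => D D0.
    exact: (optimal_gap_le hm hM D0 (opt D D0)).
- by have [pi low] := ail_lowest_exists hM D; exists pi.
- by move=> pi; apply: (ail_lowest_worst hm hM).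
- by move=> pi; apply: (worst_ail_lowest hm hM).
Qed.
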